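(* Let $D$ be a digraph on $n$ vertices that has at least one out-branching. If $D$ has minimum in-degree at least $3$, or if $D$ is an oriented graph with minimum in-degree at least $2$, then $\ell(D)\geq \frac{1}{4}\sqrt{n}$.
   Context: An out-tree of a digraph $D$ is a subgraph of $D$ that is a tree (ignoring arc directions) in which exactly one vertex, the root, has in-degree $0$ and every other vertex has in-degree $1$. An out-branching is a spanning out-tree. A leaf is a vertex of out-degree $0$ in the out-tree. $\ell(D)$ denotes the maximum number of leaves over all out-trees of $D$. A digraph is an oriented graph if $(u,v)\in A(D)$ implies $(v,u)\notin A(D)$. *)

(* Defs.v *)
From mathcomp Require Import all_boot.
Set Implicit Arguments. Unset Strict Implicit. Unset Printing Implicit Defensive.

Definition digraph (T : finType) (a : rel T) : Prop := irreflexive a.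

Definition oriented (T : finType) (a : rel T) : Prop :=
  forall u v, a u v -> ~~ a v u.

Definition indeg (T : finType) (a : rel T) (v : T) : nat := #|[set u | a u v]|.

Definition indegB (T : finType) (B : {set T * T}) (v : T) : nat :=
  #|[set u | (u, v) \in B]|.

(* (S, B) is an out-tree of D = (T, a): a subgraph (vertex set S, arc set B)
   which is a tree when ignoring directions (connected; with the in-degree
   conditions |B| = |S|-1 holds automatically), with exactly one vertex (the
   root) of in-degree 0 and all other vertices of in-degree 1. *)
Definition is_out_tree (T : finType) (a : rel T) (S : {set T}) (B : {set T * T}) : Prop :=
  [/\ (forall e, e \in B -> [&& a e.1 e.2, e.1 \in S & e.2 \in S]),
      (exists2 r, r \in S &
         indegB B r = 0 /\ forall v, v \in S -> v != r -> indegB B v = 1)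
    & (forall x y, x \in S -> y \in S ->
         connect (fun u w => ((u, w) \in B) || ((w, u) \in B)) x y)].

Definition is_out_branching (T : finType) (a : rel T) (B : {set T * T}) : Prop :=
  is_out_tree a [set: T] B.

Definition leaves (T : finType) (S : {set T}) (B : {set T * T}) : {set T} :=
  [set x in S | [forall y, (x, y) \notin B]].

(* Main.v *)
Require Import Defs.
From mathcomp Require Import all_boot zify.

Set Implicit Arguments. Unset Strict Implicit. Unset Printing Implicit Defensive.

(* Take an out-branching in which no single change of parent creates a leaf
   without destroying another.  If it has L leaves, fewer than 2L vertices do not
   have exactly one child, so its vertices split into fewer than 2L chains, in
   each of which only the bottom vertex may have a number of children other than
   one.  An interior vertex v of a chain has an in-neighbour w v which is neither
   its parent nor its child; by local optimality w v is either a leaf that is not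
   a descendant of v, or a descendant of v at distance at least 2.

   Suppose all w v are of the second kind, and root the chain at its bottom.
   Entering each v from w v, or from its parent in the chain, for a sparse enough
   set of v, gives out-trees; averaging over three such sets, one of them has a
   third of the chain as leaves.  In general let v0 be the lowest vertex of the
   first kind: the argument applies below v0 as before, and above v0 in the tree
   where v0 hangs from the leaf w v0.  So the larger of the two parts bounds the
   chain by 6m + 5, where m is the number of leaves of some out-tree, and
   (2m - 1)(6m + 5) <= 16 m^2. *)

(** * Out-trees encoded by parent maps *)

Section ParentTree.
Variables (T : finType) (a : rel T).
Implicit Types (S : {set T}) (r v : T) (par : T -> T) (h : T -> nat).

(* The rank [h] makes [par] acyclic on [S]. *)
Definition parent_tree S r par h : Prop :=
  r \in S /\ forall v, v \in S -> v != r ->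
    [/\ par v \in S, a (par v) v & h (par v) < h v].

Definition parent_arcs S r par : {set T * T} :=
  [set e | [&& e.2 \in S, e.2 != r & par e.2 == e.1]].

Definition tips S r par : {set T} :=
  [set x in S | [forall y in S, (y != r) ==> (par y != x)]].

Definition has_leaves m : Prop :=
  exists (S : {set T}) (B : {set T * T}), is_out_tree a S B /\ m <= #|leaves S B|.

Lemma has_leaves_max m n : has_leaves m -> has_leaves n -> has_leaves (maxn m n).
Proof. by rewrite /maxn; case: ifP. Qed.

Lemma leaves_parent_arcs S r par : leaves S (parent_arcs S r par) = tips S r par.
Proof.
apply/setP=> x; rewrite !inE; congr (_ && _); apply: eq_forallb => y.
by rewrite inE /=; case: (y \in S); case: (y != r); case: (par y == x).
Qed.

(** Connectedness holds because following parents strictly lowers [h], so the walk from any vertex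
    of [S] can only stop at [r]. *)
Lemma parent_tree_out_tree S r par h :
  parent_tree S r par h -> is_out_tree a S (parent_arcs S r par).
Proof.
move=> [rS parS]; split.
- move=> [u v]; rewrite inE /= => /and3P[vS vr /eqP <-].
  by have [-> -> _] := parS _ vS vr.
- exists r => //; split.
    by apply: eq_card0 => u; rewrite !inE /= eqxx andbF.
  move=> v vS vr; rewrite /indegB -(cards1 (par v)); apply: eq_card => u.
  by rewrite !inE /= vS vr eq_sym.
- set e := (X in connect X).
  have e_sym : connect_sym e.
    by apply: sym_connect_sym => u w; rewrite /e orbC.
  suff to_r x : x \in S -> connect e x r.
    by move=> x y xS yS; apply: connect_trans (to_r _ xS) _; rewrite e_sym to_r.
  have [n] := ubnP (h x); elim: n x => // n IH x hx xS.
  have [->|xr] := eqVneq x r; first exact: connect0.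
  have [pS _ hp] := parS _ xS xr.
  apply: connect_trans (IH _ (leq_trans hp hx) pS).
  by apply: connect1; rewrite /e !inE /= xS xr eqxx orbT.
Qed.

Lemma has_leaves_tips S r par h :
  parent_tree S r par h -> has_leaves #|tips S r par|.
Proof.
move=> /parent_tree_out_tree outS; exists S, (parent_arcs S r par).
by rewrite leaves_parent_arcs.
Qed.

End ParentTree.

(** Greedy colouring in order of increasing [h]: each vertex has at most two constraints towards
    lower ranks, so three colours suffice. *)
Lemma three_coloring (T : finType) (h : T -> nat) (f g : T -> T) :
  exists c : T -> 'I_3, forall v,
    (h (f v) < h v -> c v != c (f v)) /\ (h (g v) < h v -> c v != c (g v)).
Proof.
suff [c cP] : exists c : T -> 'I_3, forall v, h v < (\max_x h x).+1 ->
    (h (f v) < h v -> c v != c (f v)) /\ (h (g v) < h v -> c v != c (g v)).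
  by exists c => v; apply: cP; rewrite ltnS leq_bigmax.
elim: (\max_x h x).+1 => [|n [c cP]]; first by exists (fun=> ord0).
have third (i j : 'I_3) : exists k : 'I_3, (k != i) && (k != j).
  apply/existsP; rewrite -[[exists _, _]]negbK negb_exists; apply/negP=> /forallP ij.
  have : #|[set i; j]| <= 2 by rewrite cards2; case: (_ == _).
  suff -> : [set i; j] = setT by rewrite cardsT card_ord.
  by apply/setP=> k; have := ij k; rewrite !inE; do 2 case: eqP.
exists (fun v => if h v == n then xchoose (third (c (f v)) (c (g v))) else c v).
move=> v; rewrite ltnS leq_eqVlt => /predU1P[hv|hv].
  have /andP[kf kg] := xchooseP (third (c (f v)) (c (g v))).
  by rewrite hv eqxx; split=> lt; rewrite ltn_eqF.
by split=> lt; rewrite !ltn_eqF ?(ltn_trans lt hv) //; apply cP.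
Qed.

Lemma sum_card_fibers_le (T : finType) (f : T -> T) (X Y : {set T}) :
  \sum_(x in X) #|[set u in Y | f u == x]| <= #|Y|.
Proof.
under eq_bigr => x _ do rewrite -sum1_card.
rewrite (exchange_big_dep (mem Y)) /=; last by move=> x u _; rewrite inE => /andP[].
rewrite -sum1_card; apply: leq_sum => u uY.
rewrite sum1_card; apply/card_le1_eqP => x y.
by rewrite -!topredE /= !inE => /and3P[_ _ /eqP <-] /and3P[_ _ /eqP].

Qed.

(** * Many leaves from a path with back arcs, hung above a given out-tree *)

Section PathBackArcs.
Variables (T : finType) (a : rel T).
Variables (S0 : {set T}) (r0 : T) (par0 : T -> T) (h0 : T -> nat).
Hypothesis tree0 : parent_tree a S0 r0 par0 h0.
Variables (X : {set T}) (par w : T -> T) (pos : T -> nat).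
Hypothesis disj : [disjoint S0 & X].
Hypothesis par_arc : {in X, forall v, a (par v) v}.
Hypothesis w_arc : {in X, forall v, a (w v) v}.
Hypothesis w_in : {in X, forall v, w v \in S0 :|: X}.
Hypothesis par_inj : {in X &, injective par}.
Hypothesis top_uniq : {in X &, forall u v, par u \notin X -> par v \notin X -> u = v}.
Hypothesis pos_par : {in X, forall v, par v \in X -> pos (par v) = (pos v).+1}.
Hypothesis pos_w : {in X, forall v, w v \in X -> (pos (w v)).+2 <= pos v}.

(* Arcs of the path [X] are used into one colour class and back arcs into the
   others.  Two consecutive path arcs would have heads of the same colour, so
   every two steps towards the root decrease [pos].  A vertex [x = w u] with
   a single [u] becomes a leaf for the colour of [u], and one outside the image
   of [w] becomes a leaf for at least two colours. *)
Lemma path_back_arcs_leaves : exists2 m, has_leaves a m & #|X| <= 3 * m + 1.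
Proof.
have XS0 x : x \in X -> x \in S0 = false.
  by move=> xX; apply/negbTE; rewrite (disjointFl disj).
(* [ch x] is the next path vertex below [x], the inverse of [par] on [X]; the default occurs only
   where no vertex of [X] has parent [x]. *)
pose ch x := odflt x [pick y in X | par y == x].
have chP y : y \in X -> ch (par y) = y.
  move=> yX; rewrite /ch; case: pickP => [z /andP[zX /eqP]|/(_ y)] /=.
    by move/par_inj; apply.
  by rewrite yX eqxx.
have [c cP] := three_coloring pos ch (fun v => ch (w v)).
have c1 v : v \in X -> par v \in X -> c (par v) != c v.
  by move=> vX pX; have [+ _] := cP (par v); rewrite chP // pos_par //; apply.
have c2 u v : u \in X -> v \in X -> w u \in X -> par v = w u -> c u != c v.
  move=> uX vX wX pv; have [_ +] := cP u; rewrite -pv chP //; apply.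
  by have := pos_w uX wX; rewrite -pv pos_par ?pv //; lia.
pose up i v := (c v == i) && (par v \in X).
pose p i v := if v \in S0 then par0 v else if up i v then par v else w v.
pose M := (\max_x h0 x).+1.
(* The offset [M] ranks [X] above [S0]. A step by [par] raises [2 * pos] by 2 but loses the bonus 3,
   since two consecutive vertices are never both [up]. A step by [w] lowers [2 * pos] by at least 4
   and gains at most 3. *)
pose hh i v := if v \in S0 then h0 v
               else M + (2 * pos v + (if up i v then 3 else 0)).
have treeP i : parent_tree a (S0 :|: X) r0 (p i) (hh i).
  have [r0S par0S] := tree0; split; first by rewrite inE r0S.
  move=> v; rewrite /p /hh; case: ifP => [vS _ vr|vS].
    by have [pS av hv] := par0S _ vS vr; rewrite inE pS.
  rewrite inE vS /= => vX _; case: ifP => [/andP[/eqP cv pX]|_].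
    rewrite inE pX orbT XS0 //; split=> //; first exact: par_arc.
    have -> : up i (par v) = false by rewrite /up -cv (negbTE (c1 _ vX pX)).
    by rewrite pos_par //; lia.
  split; [exact: w_in | exact: w_arc |]; case: ifP => wS.
    by rewrite /M addSn ltnS; apply: leq_trans (leq_addr _ _); apply: leq_bigmax.
  have wX : w v \in X by have := w_in vX; rewrite inE wS.
  by have := pos_w vX wX; case: (up i (w v)); lia.
have tipP i x : x \in X -> {in X, forall y, par y = x -> c y != i} ->
    {in X, forall y, w y = x -> up i y} -> x \in tips (S0 :|: X) r0 (p i).
  move=> xX parx wx; rewrite !inE xX orbT /=.
  apply/forall_inP=> y yS; apply/implyP=> yr; apply/eqP; rewrite /p.
  case: ifP => [yS0 px|yS0].
    by have [_ /(_ y yS0 yr)[]] := tree0; rewrite px XS0.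
  have yX : y \in X by rewrite inE yS0 in yS.
  case: ifP => [/andP[cy _] px|yup wy]; first by rewrite (negbTE (parx _ yX px)) in cy.
  by rewrite wx in yup.
pose pre x := [set u in X | w u == x].
(* The top vertex of the path has its parent outside [X], so it is entered from its [w] for every
   colour, and that vertex never becomes a tip. [pret] compensates for this and sums to at most 1,
   the top being unique. *)
pose pret x := [set u in [set u in X | par u \notin X] | w u == x].
have two x : x \in X ->
    2 <= \sum_(i < 3) (x \in tips (S0 :|: X) r0 (p i)) + #|pre x| + #|pret x|.
  move=> xX; have [/eqP pre0|[u]] := set_0Vmem (pre x).
    have tipx i : i != c (ch x) -> x \in tips (S0 :|: X) r0 (p i).
      move=> ich; apply: tipP => // y yX yx.
        by rewrite -yx chP // eq_sym in ich.
      suff : y \in pre x by rewrite (eqP pre0) inE.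
      by rewrite inE yX yx eqxx.
    apply: leq_trans (leq_addr _ _); apply: leq_trans (leq_addr _ _).
    rewrite (bigD1 (c (ch x))) //=; apply: leq_trans (leq_addl _ _).
    rewrite (eq_bigr (fun=> 1)); last by move=> i ich; rewrite tipx.
    by rewrite sum1_card; have := cardC1 (c (ch x)); rewrite card_ord /= => ->.
  move=> upre; have := upre; rewrite inE => /andP[uX /eqP wu].
  have [|pre2] := leqP #|pre x| 1; last by lia.
  move/card_le1_eqP => preu.
  have : 0 < #|pre x| by apply/card_gt0P; exists u.
  have [pX|pX] := boolP (par u \in X); last first.
    have : 0 < #|pret x| by apply/card_gt0P; exists u; rewrite !inE uX pX wu eqxx.
    by lia.
  suff tipx : x \in tips (S0 :|: X) r0 (p (c u)) by rewrite (bigD1 (c u)) //= tipx; lia.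
  apply: tipP => // y yX yx; first by rewrite eq_sym (c2 _ _ uX yX) ?wu.
  by rewrite (preu _ _ upre (_ : y \in pre x)) ?inE ?yX ?yx /up ?eqxx.
have sum2 : 2 * #|X| <= \sum_(i < 3) #|tips (S0 :|: X) r0 (p i)| + #|X| + 1.
  have -> : 2 * #|X| = \sum_(x in X) 2 by rewrite sum_nat_const mulnC.
  apply: leq_trans; first by apply: leq_sum => x; exact: two.
  rewrite !big_split /=; apply: leq_add; first apply: leq_add.
  - rewrite exchange_big /=; apply: leq_sum => i _.
    rewrite -sum1_card big_mkcond /= [leqRHS]big_mkcond /=.
    by apply: leq_sum => x _; case: (x \in X); case: (x \in tips _ _ _).
  - exact: sum_card_fibers_le.
  - apply: leq_trans (sum_card_fibers_le _ _ _) _.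
    apply/card_le1_eqP => u v; rewrite !inE => /andP[uX pu] /andP[vX pv].
    exact: top_uniq.
have [i tip_i] : exists i, #|X| <= 3 * #|tips (S0 :|: X) r0 (p i)| + 1.
  apply/existsP; apply: contraLR sum2; rewrite negb_exists => /forallP small.
  have := small ord0; have := small (lift ord0 ord0).
  have := small (lift ord0 (lift ord0 ord0)).
  rewrite -!ltnNge !big_ord_recl big_ord0; lia.
by exists #|tips (S0 :|: X) r0 (p i)| => //; apply: has_leaves_tips (treeP i).
Qed.

End PathBackArcs.

(** * Ancestors, unary chains and regrafting in a rooted spanning tree *)

Section Rooted.
Variables (T : finType) (par : T -> T) (r : T).
Hypothesis par_root : par r = r.
Hypothesis to_root : forall v, fconnect par v r.

Local Notation anc u v := (fconnect par v u).
Local Notation depth v := (findex par v r).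

Definition children v := [set y | (y != r) && (par y == v)].
Definition unary v := #|children v| == 1.

Lemma childrenP u y : y \in children u -> y != r /\ par y = u.
Proof. by rewrite inE => /andP[yr /eqP]. Qed.

Lemma depth_par v : v != r -> depth v = (depth (par v)).+1.
Proof. by move=> vr; apply: fconnect_findex => //; rewrite eq_sym. Qed.

Lemma anc_par u v : u != v -> anc u v -> anc u (par v).
Proof. by move=> uv; rewrite fconnect_eqVf eq_sym (negbTE uv). Qed.

Lemma anc_up u v : anc u (par v) -> anc u v.
Proof. by move=> uv; rewrite fconnect_eqVf uv orbT. Qed.

Lemma anc_trans y x z : anc x y -> anc y z -> anc x z.
Proof. by move=> xy yz; apply: connect_trans yz xy. Qed.

Lemma anc_root u : anc u r -> u = r.
Proof. by move/iter_findex <-; elim: (findex _ _ _) => //= n ->. Qed.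

Lemma anc_depth u v : anc u v -> depth u <= depth v.
Proof.
move/iter_findex <-; elim: (findex par v u) => //= n IH; apply: leq_trans IH.
set x := iter _ _ _; have [->|xr] := eqVneq x r; first by rewrite par_root.
by rewrite (depth_par xr).
Qed.

Lemma anc_depth_lt u v : anc u v -> u != v -> depth u < depth v.
Proof.
move=> uv ne; have vr : v != r.
  by apply: contraNneq ne => vr; rewrite vr in uv *; rewrite (anc_root uv).
by rewrite (depth_par vr) ltnS; apply/anc_depth/anc_par.
Qed.

Lemma anc_anti u v : anc u v -> anc v u -> u = v.
Proof.
move=> uv vu; apply/eqP; apply: contraTT (anc_depth vu) => ne.
by rewrite -ltnNge; apply: anc_depth_lt.
Qed.

Lemma anc_total u v x : anc u x -> anc v x -> anc u v || anc v u.
Proof.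
move=> /iter_findex <- /iter_findex <-.
set i := findex _ _ u; set j := findex _ _ v.
by have [ij|/ltnW ij] := leqP i j; rewrite -(subnK ij) iterD fconnect_iter ?orbT.
Qed.

Lemma anc_child u v : anc u v -> u != v -> exists2 y, y \in children u & anc y v.
Proof.
have [n] := ubnP (depth v); elim: n v => // n IH v vn uv ne.
have vr : v != r.
  by apply: contraNneq ne => vr; rewrite vr in uv *; rewrite (anc_root uv).
have [pv|pv] := eqVneq u (par v); first by exists v; rewrite ?inE ?vr ?pv /=.
rewrite (depth_par vr) ltnS in vn.
have [y yu yv] := IH _ vn (anc_par ne uv) pv.
by exists y => //; apply: anc_up.
Qed.

Lemma unary_child v y x :
  unary v -> y \in children v -> anc v x -> x != v -> anc y x.
Proof.
move=> /cards1P[z cz] yv vx xv; have vx' : v != x by rewrite eq_sym.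
have [y' + y'x] := anc_child vx vx'.
by move: yv; rewrite cz !inE => /eqP -> /eqP <-.
Qed.

(** Nothing is required of [b] itself, which may be a leaf or a branching vertex; this is how a
    chain ends. *)
Definition chain b := [set v | anc v b &
  [forall x, [&& anc v x, anc x b & x != b] ==> unary x]].

Lemma chainP b v : reflect
  (anc v b /\ forall x, anc v x -> anc x b -> x != b -> unary x) (v \in chain b).
Proof.
rewrite inE; apply: (iffP andP) => -[vb ub]; split=> //.
  by move=> x vx xb ne; have /forallP/(_ x) := ub; rewrite vx xb ne.
by apply/forallP=> x; apply/implyP=> /and3P[]; apply: ub.
Qed.

(** Descend from [v] through only children until a non-unary vertex is met; the depth grows and is
    below [#|T|]. *)
Lemma chain_cover v : exists2 b, ~~ unary b & v \in chain b.
Proof.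
have [n] := ubnP (#|T| - depth v); elim: n v => // n IH v vn.
have [uv|nuv] := boolP (unary v); last first.
  exists v => //; apply/chainP; split=> // x vx xv.
  by rewrite (anc_anti vx xv) eqxx.
have /cards1P[y cy] := uv.
have yv : y \in children v by rewrite cy inE.
have [yr py] := childrenP yv.
have dv : depth v < #|T| by apply: leq_trans (findex_max (to_root v)) (max_card _).
have dy := depth_par yr; rewrite py in dy.
have [|b nub /chainP[yb ub]] := IH y; first by rewrite dy; lia.
have vy : anc v y by rewrite -py fconnect1.
exists b => //; apply/chainP; split; first exact: anc_trans vy yb.
move=> x vx xb ne; have [->//|xv] := eqVneq x v.
by apply: ub => //; apply: unary_child vx xv.
Qed.

Lemma card_le_chains c :
  (forall b, ~~ unary b -> #|chain b| <= c) ->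
  #|T| <= #|[set b | ~~ unary b]| * c.
Proof.
move=> small; rewrite -cardsT.
apply: (@leq_trans #|\bigcup_(b in [set b | ~~ unary b]) chain b|).
  apply/subset_leq_card/subsetP => v _; have [b nub vb] := chain_cover v.
  by apply/bigcupP; exists b; first rewrite inE.
apply: leq_trans (_ : \sum_(b in [set b | ~~ unary b]) #|chain b| <= _).
  apply: (big_ind2 (fun (A : {set T}) n => #|A| <= n)) => [|A m B n Am Bn|//].
    by rewrite cards0.
  by apply: leq_trans (leq_add Am Bn); rewrite cardsU leq_subr.
by rewrite -sum_nat_const; apply: leq_sum => b; rewrite inE => /small.
Qed.

Lemma tips_setT : tips setT r par = [set x | children x == set0].
Proof.
apply/setP=> x; rewrite !inE /=; apply/forall_inP/eqP => [noy|cx y _].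
  apply/setP=> y; rewrite !inE; apply/negP=> /andP[yr yx].
  by have := noy y (in_setT _); rewrite yr yx.
by apply/implyP=> yr; apply/negP=> yx; have := in_set0 y; rewrite -cx inE yr yx.
Qed.

(** Each vertex satisfies [1 + ~~ unary v <= #|children v| + 2 * (children v == set0)]. Summing and
    using that the numbers of children total at most [#|T| - 1] gives the strict bound. *)
Lemma card_non_unary : #|[set b | ~~ unary b]| < 2 * #|tips setT r par|.
Proof.
have T1 : 0 < #|T| by apply/card_gt0P; exists r.
have : \sum_v (1 + ~~ unary v) <= \sum_v (#|children v| + 2 * (children v == set0)).
  apply: leq_sum => v _; rewrite /unary -cards_eq0.
  by case: #|children v| => [|[|n]] //=; lia.
have -> : \sum_v (1 + ~~ unary v) = #|T| + #|[set b | ~~ unary b]|.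
  rewrite big_split /= sum1_card; congr addn.
  by rewrite -sum1_card [RHS]big_mkcond; apply: eq_bigr => v _; rewrite inE; case: unary.
have := sum_card_fibers_le par setT [set~ r]; rewrite cardsC1.
have -> : \sum_(x in setT) #|[set u in [set~ r] | par u == x]| = \sum_v #|children v|.
  apply: eq_big => x; rewrite ?inE // => _; apply: eq_card => u.
  by rewrite !inE.
rewrite big_split -big_distrr /=.
have -> : \sum_v (children v == set0) = #|tips setT r par|.
  rewrite tips_setT -sum1_card [RHS]big_mkcond; apply: eq_bigr => v _.
  by rewrite inE; case: eqP.
by move: T1; move: (\sum_v _) #|T| (#|[set b | _]|) (#|tips _ _ _|) => m n k l; lia.
Qed.

(** No cycle arises because [u] is not a descendant of [v]: the subtree of [v] moves as a whole, and
    adding [depth u + 1] to its ranks lifts it above [u]. A general [S] allows parts of the tree to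
    be dropped. *)
Lemma regraft (a : rel T) (S : {set T}) v u :
  (forall x, x != r -> a (par x) x) -> r \in S -> a u v -> ~~ anc v u ->
  (forall x, x \in S -> x != r -> (if x == v then u else par x) \in S) ->
  exists h, parent_tree a S r (fun x => if x == v then u else par x) h.
Proof.
move=> arc rS uv vu clS.
exists (fun x => if anc v x then (depth u).+1 + depth x else depth x).
split=> // x xS xr; split; first exact: clS.
  by case: eqP => [->|_] //; apply: arc.
have [->|xv] := eqVneq x v; first by rewrite connect0 (negbTE vu); lia.
have -> : anc v (par x) = anc v x.
  by apply/idP/idP => [/anc_up//|]; apply: anc_par; rewrite eq_sym.
by rewrite (depth_par xr); case: ifP; lia.
Qed.

End Rooted.

(** * Bounding one chain of a locally optimal out-branching *)

Section OutBranching.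
Variables (T : finType) (a : rel T) (par : T -> T) (r : T).
Hypothesis par_root : par r = r.
Hypothesis to_root : forall v, fconnect par v r.
Hypothesis par_arc : forall v, v != r -> a (par v) v.

Local Notation anc u v := (fconnect par v u).
Local Notation depth v := (findex par v r).
Local Notation children := (children par r).
Local Notation unary := (unary par r).
Local Notation chain := (chain par r).

(** Local optimality: if [u] were not a leaf, hanging [v] from it would make [par v] a leaf at no
    cost. *)
Hypothesis no_gain : forall u v, v != r -> unary (par v) -> a u v ->
  u != par v -> ~~ anc v u -> children u = set0.

Variable b : T.

(** The interior of the chain: [b] is removed, and so is the top vertex, which is the root or has a
    non-unary parent. *)
Let G := [set v in chain b | [&& v != b, v != r & unary (par v)]].

Lemma chain_anc v : v \in chain b -> anc v b.
Proof. by case/chainP. Qed.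

Lemma chain_unary v : v \in chain b -> v != b -> unary v.
Proof. by case/chainP=> vb; apply; rewrite ?connect0. Qed.

Lemma chain_down v x : v \in chain b -> anc v x -> anc x b -> x \in chain b.
Proof.
case/chainP=> _ ub vx xb; apply/chainP; split=> // y xy.
by apply: ub; apply: anc_trans vx xy.
Qed.

(** Nothing branches off a chain before its bottom. *)
Lemma chain_desc v x : v \in chain b -> anc v x -> (x \in chain b) || anc b x.
Proof.
have [n] := ubnP (depth b - depth v); elim: n v => // n IH v vn vC vx.
have [vb|vb] := eqVneq v b; first by rewrite -vb vx orbT.
have [->|xv] := eqVneq x v; first by rewrite vC.
have [y yv yb] := anc_child par_root to_root (chain_anc vC) vb.
have [yr py] := childrenP yv.
have vy : anc v y by rewrite -py fconnect1.
have yn : depth b - depth y < n.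
  have := anc_depth par_root to_root yb.
  by have := depth_par to_root yr; rewrite py; lia.
apply: IH yn (chain_down vC vy yb) _.
exact: (unary_child par_root to_root (chain_unary vC vb) yv vx xv).
Qed.

Lemma interior v : v \in G -> [/\ v \in chain b, v != b, v != r & unary (par v)].
Proof. by rewrite inE => /andP[-> /and3P[]]. Qed.

Lemma interior_below y x : y \in chain b -> x \in chain b ->
  anc y x -> y != x -> x != b -> x \in G.
Proof.
move=> yC xC yx ne xb; have xr : x != r.
  apply: contraNneq ne => xr; rewrite xr in yx *.
  by rewrite (anc_root par_root yx).
rewrite inE xC xb xr /=; have ypx := anc_par ne yx.
have pxb : anc (par x) b by apply: anc_trans (chain_anc xC); apply: fconnect1.
apply: chain_unary; first exact: chain_down yC ypx pxb.
apply: contraTneq (anc_depth par_root to_root (chain_anc xC)) => <-.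
by rewrite -ltnNge (depth_par to_root xr).
Qed.

Lemma chain_top x y : x \in chain b -> y \in chain b -> x != b -> y != b ->
  x \notin G -> y \notin G -> x = y.
Proof.
move=> xC yC xb yb xG yG; apply/eqP; apply/negPn/negP => ne.
have /orP[xy|yx] := anc_total (chain_anc xC) (chain_anc yC).
  by rewrite (interior_below xC yC xy) in yG.
by rewrite (interior_below yC xC yx) // eq_sym in xG.
Qed.

Lemma par_interior v : v \in G -> par v \in chain b /\ par v != b.
Proof.
case/interior=> vC vb vr up; split.
  apply/chainP; split; first by apply: anc_trans (chain_anc vC); apply: fconnect1.
  move=> x px xb ne; have [->//|xp] := eqVneq x (par v).
  have vx : anc v x.
    by apply: (unary_child par_root to_root up _ px xp); rewrite inE vr eqxx.
  by apply: chain_unary ne; apply: chain_down vC vx xb.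
apply: contraTneq (anc_depth par_root to_root (chain_anc vC)) => <-.
by rewrite -ltnNge (depth_par to_root vr).
Qed.

Lemma par_interior_inj : {in G &, injective par}.
Proof.
move=> u v /interior[_ _ ur /cards1P[z cz]] /interior[_ _ vr _] e.
have : u \in children (par u) by rewrite inE ur eqxx.
have : v \in children (par u) by rewrite inE vr e eqxx.
by rewrite cz !inE => /eqP -> /eqP ->.
Qed.

(** The 2 accounts for [b] and for the top vertex, unique because of two comparable candidates the
    lower one is interior. *)
Lemma card_chain : #|chain b| <= #|G| + 2.
Proof.
have : #|chain b :\: (b |: G)| <= 1.
  apply/card_le1_eqP=> x y; rewrite !in_setD !in_setU1 !negb_or.
  by move=> /andP[/andP[xb xG] xC] /andP[/andP[yb yG] yC]; apply: chain_top.
have := cardsID (b |: G) (chain b).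
have : #|chain b :&: (b |: G)| <= #|b |: G| by rewrite subset_leq_card ?subsetIr.
by rewrite cardsU1; lia.
Qed.

Hypothesis irr : irreflexive a.
Hypothesis indeg_a : (forall v, 3 <= indeg a v) \/
  (oriented a /\ forall v, 2 <= indeg a v).

Let w v := odflt v [pick u | [&& a u v, u != par v & u \notin children v]].

(** An interior vertex has one parent and one child [y], so in-degree 3 leaves another in-neighbour.
    In an oriented graph the arc from [v] to [y] rules out [y] as an in-neighbour, and in-degree 2
    is enough. Hence the default in [w] is never taken on [G]. *)
Lemma back_arc v : v \in G -> [&& a (w v) v, w v != par v & w v \notin children v].
Proof.
move=> vG; rewrite /w; case: pickP => //= none; exfalso.
have [vC vb vr _] := interior vG; have /cards1P[y cy] := chain_unary vC vb.
have sub : [set u | a u v] \subset [set par v; y].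
  apply/subsetP=> u; rewrite !inE => uv; have := none u; rewrite uv cy inE /=.
  by case: (u == par v) => //= /negbFE.
have sub_le := subset_leq_card sub.
case: indeg_a => [d3|[ori d2]].
  have := leq_trans (d3 v) sub_le; rewrite cards2; by case: (_ == _).
have : [set u | a u v] \subset [set par v].
  apply/subsetP=> u uv; have := subsetP sub _ uv; rewrite !inE => /orP[//|/eqP uy].
  have : y \in children v by rewrite cy inE.
  rewrite inE in uv; rewrite inE => /andP[/par_arc + /eqP pv]; rewrite pv => vy.
  by have := ori _ _ vy; rewrite -uy uv.
by move/subset_leq_card/(leq_trans (d2 v)); rewrite cards1.
Qed.

(* The vertices of the first kind. *)
Let A := [set v in G | ~~ anc v (w v)].

Lemma outer_leaf v : v \in A -> children (w v) = set0.
Proof.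
rewrite inE => /andP[vG wv]; have /and3P[avw wp _] := back_arc vG.
by have [_ _ vr up] := interior vG; apply: no_gain vr up avw wp wv.
Qed.

(** Here [w v] is a descendant of [v], distinct from it as [a] is irreflexive, and not a child. *)
Lemma inner_depth v : v \in G -> v \notin A -> depth v + 2 <= depth (w v).
Proof.
move=> vG; rewrite inE vG negbK => vw; have /and3P[avw _ wc] := back_arc vG.
have ne : v != w v by apply: contraTneq avw => <-; rewrite irr.
have [y yv yw] := anc_child par_root to_root vw ne.
have [yr py] := childrenP yv.
have yne : y != w v by apply: contraNneq wc => <-.
have := anc_depth_lt par_root to_root yw yne.
by have := depth_par to_root yr; rewrite py; lia.
Qed.

Lemma inner_interior v : v \in G -> v \notin A -> (w v \in G) || anc b (w v).
Proof.
move=> vG vA; have dv := inner_depth vG vA; have [vC _ _ _] := interior vG.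
have vw : anc v (w v) by move: vA; rewrite inE vG negbK.
have [wb|wb] := eqVneq (w v) b; first by rewrite wb connect0 orbT.
have /orP[wC|->] := chain_desc vC vw; last by rewrite orbT.
rewrite (interior_below vC wC) //; apply: contraTneq dv => <-; lia.
Qed.

(** Any suitable part of the interior can serve as the path, with the height above [b] as [pos]. If
    [w v] is itself interior it is unary, hence not a leaf, so [v] is of the second kind and
    [inner_depth] applies. *)
Lemma interior_part_leaves (S0 : {set T}) r0 par0 h0 (X : {set T}) :
  parent_tree a S0 r0 par0 h0 -> X \subset G -> [disjoint S0 & X] ->
  {in X, forall v, w v \in S0 :|: X} ->
  {in X &, forall u v, par u \notin X -> par v \notin X -> par u = par v} ->
  exists2 m, has_leaves a m & #|X| <= 3 * m + 1.
Proof.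
move=> tree0 /subsetP XG disj wX top.
apply: (path_back_arcs_leaves tree0 (par := par) (w := w)
          (pos := fun v => depth b - depth v)) => //.
- by move=> v /XG/interior[_ _ vr _]; apply: par_arc.
- by move=> v /XG/back_arc/and3P[].
- by move=> u v /XG uG /XG vG; apply: par_interior_inj.
- by move=> u v uX vX pu pv; apply: par_interior_inj (top _ _ uX vX pu pv); apply: XG.
- move=> v /XG/interior[vC _ vr _] _.
  have := anc_depth par_root to_root (chain_anc vC).
  by have := depth_par to_root vr; lia.
- move=> v /XG vG /XG wG; have [wC wb _ _] := interior wG.
  have vA : v \notin A.
    apply: contraTN (chain_unary wC wb) => /outer_leaf c0.
    by rewrite /unary c0 cards0.
  have := anc_depth par_root to_root (chain_anc wC).
  by have := inner_depth vG vA; lia.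
Qed.

Lemma tree_below : parent_tree a [set x | anc b x] b par (fun x => depth x).
Proof.
split; first by rewrite inE connect0.
move=> v; rewrite inE => bv vb; have bv' : b != v by rewrite eq_sym.
have vr : v != r.
  by apply: contraNneq vb => vr; rewrite vr in bv *; rewrite (anc_root par_root bv).
by rewrite inE (anc_par bv' bv) (depth_par to_root vr) (par_arc vr).
Qed.

Lemma disjoint_below (X : {set T}) : X \subset G -> [disjoint [set x | anc b x] & X].
Proof.
move/subsetP=> XG; rewrite disjoints_subset; apply/subsetP=> x; rewrite !inE => bx.
apply/negP=> /XG/interior[xC xb _ _].
by rewrite (anc_anti par_root to_root bx (chain_anc xC)) eqxx in xb.
Qed.

Lemma card_interior0 : A = set0 -> exists2 m, has_leaves a m & #|G| <= 3 * m + 1.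
Proof.
move=> A0; apply: (interior_part_leaves tree_below) => //.
- exact: disjoint_below.
- move=> v vG; rewrite !in_setU orbC inE; apply: inner_interior => //.
  by rewrite A0 inE.
- move=> u v uG vG pu pv; have [puC pub] := par_interior uG.
  by have [pvC pvb] := par_interior vG; apply: chain_top.
Qed.

(** Below the deepest vertex of [A] all vertices are of the second kind, so their [w] stays in this
    part or falls into the subtree of [b]. *)
Lemma card_interior_below v0 : v0 \in A ->
  (forall v, v \in A -> depth v <= depth v0) ->
  exists2 m, has_leaves a m & #|[set v in G | anc v0 v & v != v0]| <= 3 * m + 1.
Proof.
move=> v0A deepest; have v0G : v0 \in G by move: v0A; rewrite inE => /andP[].
have [v0C v0b v0r _] := interior v0G.
set X := [set v in _ | _ & _].
have XP v : v \in X -> [/\ v \in G, anc v0 v, v != v0 & v \notin A].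
  rewrite inE => /and3P[vG v0v ne]; split=> //; apply/negP=> /deepest.
  by rewrite leqNgt (anc_depth_lt par_root to_root v0v) // eq_sym.
have XG : X \subset G by apply/subsetP=> v /XP[].
apply: (interior_part_leaves tree_below) => //; first exact: disjoint_below.
- move=> v vX; have [vG v0v ne vA] := XP _ vX; rewrite !in_setU orbC.
  have dv := inner_depth vG vA; have dv0 := anc_depth par_root to_root v0v.
  have vw : anc v (w v) by move: vA; rewrite inE vG negbK.
  case/orP: (inner_interior vG vA) => wG; last by rewrite [X in _ || X]inE wG orbT.
  rewrite [X in X || _]inE wG (anc_trans v0v vw) /=.
  by rewrite (_ : w v != v0) //; apply: contraTneq dv => ->; lia.
- have topv v : v \in X -> par v \notin X -> par v = v0.
    move=> vX; have [vG v0v ne _] := XP _ vX; have [pC pb] := par_interior vG.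
    have v0p : anc v0 (par v) by apply: anc_par => //; rewrite eq_sym.
    apply: contraNeq => pne; rewrite inE v0p pne !andbT.
    by apply: (interior_below v0C pC v0p) => //; rewrite eq_sym.
  by move=> u v uX vX /(topv _ uX) -> /(topv _ vX) ->.
Qed.

(** The base tree consists of the vertices outside all subtrees of the chain, together with the
    subtree of [v0] rehung from [w v0]. The part above [v0] is thereby freed to be entered by its
    own arcs. *)
Lemma card_interior_above v0 : v0 \in A ->
  exists2 m, has_leaves a m & #|[set v in G | anc v v0 & v != v0]| <= 3 * m + 1.
Proof.
move=> v0A; have v0G : v0 \in G by move: v0A; rewrite inE => /andP[].
have [v0C v0b v0r _] := interior v0G.
set X := [set v in _ | _ & _].
pose out := [set x | [forall v in chain b, ~~ anc v x]].
have outP x v : x \in out -> v \in chain b -> ~~ anc v x.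
  by rewrite inE => /forall_inP; apply.
have out_up x y : x \in out -> anc y x -> y \in out.
  move=> xo yx; rewrite inE; apply/forall_inP=> v vC.
  by apply: contra (outP _ _ xo vC) => vy; apply: anc_trans vy yx.
(* If [w v] lay below a chain vertex, it would be a descendant of [v], or a chain vertex above [v];
   the latter is unary, but [w v] is a leaf. *)
have w_out v : v \in A -> w v \in out.
  move=> vA; have leafw := outer_leaf vA.
  have [vG vw] : v \in G /\ ~~ anc v (w v) by move: vA; rewrite inE => /andP.
  have [vC _ _ _] := interior vG.
  rewrite inE; apply/forall_inP=> v' v'C; apply/negP=> v'w.
  have /orP[vv'|v'v] := anc_total (chain_anc vC) (chain_anc v'C).
    by rewrite (anc_trans vv' v'w) in vw.
  have /orP[wC|bw] := chain_desc v'C v'w; last first.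
    by rewrite (anc_trans (chain_anc vC) bw) in vw.
  have [wb|wb] := eqVneq (w v) b; first by rewrite wb (chain_anc vC) in vw.
  by have := chain_unary wC wb; rewrite /unary leafw cards0.
pose S0 := out :|: [set x | anc v0 x].
have w0 : w v0 \in out := w_out _ v0A.
have /and3P[aw0 _ _] := back_arc v0G.
have nw0 : ~~ anc v0 (w v0) by move: v0A; rewrite inE => /andP[].
have rS : r \in S0 by rewrite inE (out_up _ _ w0 (to_root _)).
have [h tree0] : exists h,
    parent_tree a S0 r (fun x => if x == v0 then w v0 else par x) h.
  apply: (regraft to_root par_arc rS aw0 nw0) => x xS xr.
  case: eqVneq => [_|xv0]; first by rewrite inE w0.
  move: xS; rewrite !in_setU => /orP[xo|].
    by rewrite (out_up _ _ xo) // fconnect1.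
  by rewrite !(in_set (fun _ => _)) => v0x; rewrite anc_par ?orbT // eq_sym.
have XP v : v \in X -> [/\ v \in G, anc v v0 & v != v0] by rewrite inE => /and3P[].
apply: (interior_part_leaves tree0); first by apply/subsetP=> v /XP[].
- rewrite disjoints_subset; apply/subsetP=> x; rewrite in_setC => xS0.
  apply/negP=> /XP[xG xv0 ne]; have [xC _ _ _] := interior xG.
  move: xS0; rewrite in_setU => /orP[xo|].
    by have := outP _ _ xo xC; rewrite connect0.
  by rewrite inE => v0x; rewrite (anc_anti par_root to_root v0x xv0) eqxx in ne.
- move=> v /XP[vG vv0 ne]; rewrite !in_setU; have [vC _ _ _] := interior vG.
  have [vA|vA] := boolP (v \in A); first by rewrite w_out.
  rewrite -orbA; apply/orP; right; rewrite [X in X || _]inE.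
  have [//|nv0w /=] := boolP (anc v0 (w v)).
  case/orP: (inner_interior vG vA) => [wG|bw]; last first.
    by rewrite (anc_trans (chain_anc v0C) bw) in nv0w.
  have [wC _ _ _] := interior wG; rewrite inE wG /=.
  have := anc_total (chain_anc wC) (chain_anc v0C); rewrite (negbTE nv0w) orbF => -> /=.
  by apply: contraNneq nv0w => ->.
- have topv v : v \in X -> par v \notin X ->
      [/\ par v \in chain b, par v != b & par v \notin G].
    case/XP=> vG vv0 ne; have [pC pb] := par_interior vG => pX; split=> //.
    apply: contra pX => pG; rewrite inE pG /=.
    rewrite (anc_trans (fconnect1 _ _) vv0) /=.
    have [_ _ vr _] := interior vG.
    apply: contraTneq (anc_depth par_root to_root vv0) => <-.
    by rewrite -ltnNge (depth_par to_root vr).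
  move=> u v uX vX /(topv _ uX)[puC pub puG] /(topv _ vX)[pvC pvb pvG].
  exact: chain_top.
Qed.

(** Two parts of size at most [3 * m + 1], the vertex [v0], and the two vertices of the chain
    outside [G] add up to [6 * m + 5]. *)
Lemma card_chain_le : exists2 m, has_leaves a m & #|chain b| <= 6 * m + 5.
Proof.
have leC := card_chain; have [A0|[v1 v1A]] := set_0Vmem A.
  by have [m tm leG] := card_interior0 A0; exists m => //; lia.
pose v0 := [arg max_(v > v1 in A) depth v].
have [v0A deepest] : v0 \in A /\ forall v, v \in A -> depth v <= depth v0.
  by rewrite /v0; case: arg_maxnP => // v vA vmax; split=> // u /vmax.
have [m1 tm1 le1] := card_interior_below v0A deepest.
have [m2 tm2 le2] := card_interior_above v0A.
have v0G : v0 \in G by move: v0A; rewrite inE => /andP[].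
have [v0C _ _ _] := interior v0G.
have sub : G \subset v0 |: ([set v in G | anc v0 v & v != v0] :|:
                           [set v in G | anc v v0 & v != v0]).
  apply/subsetP=> v vG; rewrite in_setU1 in_setU.
  have [//|ne /=] := eqVneq v v0; have [vC _ _ _] := interior vG.
  have /orP[vv0|v0v] := anc_total (chain_anc vC) (chain_anc v0C); apply/orP.
    by right; rewrite inE vG vv0.
  by left; rewrite inE vG v0v.
exists (maxn m1 m2); first exact: has_leaves_max.
by have := subset_leq_card sub; rewrite cardsU1 cardsU; lia.
Qed.

End OutBranching.

(** * Locally optimal out-branchings and the final count *)

Section Spanning.
Variables (T : finType) (a : rel T).

Definition spanning (par : T -> T) (r : T) : Prop :=
  [/\ par r = r, forall v, fconnect par v r & forall v, v != r -> a (par v) v].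

Lemma out_branching_spanning B : is_out_branching a B -> exists par r, spanning par r.
Proof.
move=> [arcB [r _ [r0 in1]] conn].
(* The default makes the root its own parent, as no arc of [B] enters it. *)
pose par v := odflt v [pick u | (u, v) \in B].
have noin_r u : (u, r) \notin B.
  by apply/negP=> ur; have /card0_eq/(_ u) := r0; rewrite inE ur.
have parP u v : (u, v) \in B -> par v = u.
  move=> uvB; rewrite /par; case: pickP => [u' u'vB|/(_ u)]; last by rewrite uvB.
  have vr : v != r by apply: contraTneq uvB => ->.
  have /eqP/cards1P[z Ez] := in1 v (in_setT v) vr.
  have : u \in [set z] by rewrite -Ez inE.
  have : u' \in [set z] by rewrite -Ez inE.
  by rewrite !inE => /eqP -> /eqP ->.
have par_r : par r = r.
  by rewrite /par; case: pickP => // u; rewrite (negbTE (noin_r u)).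
have parB v : v != r -> (par v, v) \in B.
  move=> vr; rewrite /par; case: pickP => //= none.
  by have := in1 v (in_setT v) vr; rewrite /indegB eq_card0 // => u; rewrite inE none.
exists par, r; split=> // [v|v /parB/arcB/and3P[]//].
have /connectP[p] := conn r v (in_setT r) (in_setT v).
(* Induction along an undirected path from [r]: its last edge leads to a child or to the parent of a
   vertex already known to reach [r]. *)
elim/last_ind: p v => [|p y IH] v /=; first by move=> _ ->.
rewrite rcons_path last_rcons => /andP[/IH/(_ erefl) to_r step] ->.
case/orP: step => /parP py; first by rewrite fconnect_eqVf py to_r orbT.
rewrite fconnect_eqVf py in to_r; case/orP: to_r => // /eqP xr.
by move: py; rewrite xr par_r => <-; apply: connect0.
Qed.

Lemma parent_tree_spanning r p h :
  parent_tree a setT r p h -> spanning (fun x => if x == r then r else p x) r.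
Proof.
move=> [_ treeP]; split=> [|v|v vr]; first by rewrite eqxx.
  have [n] := ubnP (h v); elim: n v => // n IH v vn.
  have [->|vr] := eqVneq v r; first exact: connect0.
  have [_ _ hv] := treeP _ (in_setT v) vr.
  by rewrite fconnect_eqVf (negbTE vr); apply: IH; apply: leq_trans hv vn.
by rewrite (negbTE vr); have [] := treeP _ (in_setT v) vr.
Qed.

Lemma spanning_has_leaves par r : spanning par r -> has_leaves a #|tips setT r par|.
Proof.
case=> par_root to_root arc.
apply: (@has_leaves_tips _ _ _ _ _ (fun v => findex par v r)); split=> // v _ vr.
by rewrite (depth_par to_root vr) arc.
Qed.

(* Detaching [v] from a parent without other children makes that parent a new
   leaf, and no leaf is lost when [v] is attached to an inner vertex. *)
Lemma regraft_gain par r u v : spanning par r ->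
  v != r -> unary par r (par v) -> a u v -> u != par v -> ~~ fconnect par u v ->
  children par r u != set0 ->
  exists2 par', spanning par' r & #|tips setT r par| < #|tips setT r par'|.
Proof.
move=> [par_root to_root arc] vr up uv upv nvu cu.
have [h] := regraft (S := setT) to_root arc (in_setT r) uv nvu (fun _ _ _ => in_setT _).
move/parent_tree_spanning; set par' := (X in spanning X) => sp'; exists par' => //.
have par'E y : y != r -> par' y = if y == v then u else par y.
  by rewrite /par' => /negbTE ->.
have [par_root' _ _] := sp'; rewrite !tips_setT //; apply: proper_card; apply/properP.
have vc : v \in children par r (par v) by rewrite inE vr eqxx.
split; last first.
  exists (par v); rewrite inE; last by apply/set0Pn; exists v.
  apply/eqP/setP=> y; rewrite !inE; apply/negP=> /andP[yr]; rewrite par'E //.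
  case: (eqVneq y v) => [_|yv yp]; first by rewrite (negbTE upv).
  have yc : y \in children par r (par v) by rewrite inE yr.
  case/cards1P: up => z cz; move: vc yc yv; rewrite cz !inE.
  by move=> /eqP -> /eqP ->; rewrite eqxx.
apply/subsetP=> x; rewrite !inE => /eqP cx; apply/eqP/setP=> y; rewrite !inE.
apply/negP=> /andP[yr]; rewrite par'E //; case: ifP => [_ /eqP ux|_ yx].
  by rewrite ux cx eqxx in cu.
by have := in_set0 y; rewrite -cx inE yr yx.
Qed.

(** Each improving regraft adds a tip, and there are at most [#|T|] tips, so the process stops. *)
Lemma spanning_no_gain par r : spanning par r -> exists2 par', spanning par' r &
  forall u v, v != r -> unary par' r (par' v) -> a u v ->
    u != par' v -> ~~ fconnect par' u v -> children par' r u = set0.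
Proof.
have [n] := ubnP (#|T| - #|tips setT r par|); elim: n par => // n IH par parn sp.
pose gain := [exists e : T * T, [&& e.2 != r, unary par r (par e.2), a e.1 e.2,
  e.1 != par e.2, ~~ fconnect par e.1 e.2 & children par r e.1 != set0]].
have [/existsP[[u v] /= /and5P[vr up uv upv /andP[nvu cu]]]|nogain] := boolP gain.
  have [par' sp' lt] := regraft_gain sp vr up uv upv nvu cu.
  apply: IH sp'; have := max_card (tips setT r par'); lia.
exists par => // u v vr up uv upv nvu; apply/eqP; apply: contraNT nogain => cu.
by apply/existsP; exists (u, v); rewrite /= vr up uv upv nvu cu.
Qed.

End Spanning.

(* ell(D) >= sqrt(n)/4  is stated as: some out-tree has k leaves with 16 k^2 >= n. *)
Theorem theorem4 (T : finType) (a : rel T) :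
  digraph a ->
  (exists B : {set T * T}, is_out_branching a B) ->
  ((forall v, 3 <= indeg a v) \/ (oriented a /\ forall v, 2 <= indeg a v)) ->
  exists (S : {set T}) (B : {set T * T}),
    is_out_tree a S B /\ #|T| <= 16 * #|leaves S B| ^ 2.
Proof.
move=> irr [B /out_branching_spanning[par0 [r sp0]]] deg.
have [par sp no_gain] := spanning_no_gain sp0.
have [par_root to_root arc] := sp.
have [b0 b0P _] := chain_cover par_root to_root r.
(* A longest chain is taken, so that a single [m] bounds all chains. *)
case: (@arg_maxnP _ b0 (fun b => ~~ unary par r b) (fun b => #|chain par r b|) b0P).
rewrite /= => b _ bmax.
have [m lm chain_b] := card_chain_le par_root to_root arc no_gain b irr deg.
have small b' : ~~ unary par r b' -> #|chain par r b'| <= 6 * m + 5.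
  by move/bmax => le; apply: leq_trans chain_b.
have nT := card_le_chains par_root to_root small.
have lt := card_non_unary par r.
have [S [B0 [tS le]]] := has_leaves_max lm (spanning_has_leaves sp).
exists S, B0; split=> //.
rewrite geq_max in le; case/andP: le => le1 le2; apply: leq_trans nT _.
set L := #|leaves S B0| in le1 le2 *; set q := #|[set _ | _]| in lt *.
(* The final estimate is [(2 * L - 1) * (6 * L + 5) = 12 * L ^ 2 + 4 * L - 5], which is at most
   [16 * L ^ 2]; positivity of [L] makes the truncated subtraction exact. *)
have q_le : q <= 2 * L - 1 by lia.
apply: leq_trans (leq_mul q_le (_ : _ <= 6 * L + 5)) _; first by lia.
have L0 : 0 < L by lia.
by case: L L0 {le1 le2 q_le} => // L _; rewrite -mulnn; nia.
Qed.
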